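(* Let Alice measure $A\in\{x,y\}$ with outcomes $a\in\{+,-\}$, and let Bob's unnormalised conditional qubit states be $\sigma_{a|A}=p(a|A)\,\rho_{a|A}$. Suppose these admit a local hidden state model, i.e. there are a probability distribution $p(\lambda)$ (with $\sum_\lambda p(\lambda)=1$), conditional probability distributions $p(a|A,\lambda)$ (with $\sum_{a}p(a|A,\lambda)=1$ for each $A,\lambda$), and qubit density matrices $\rho_\lambda$ such that $\sigma_{a|A}=\sum_\lambda p(\lambda)\,p(a|A,\lambda)\,\rho_\lambda$ for all $a\in\{+,-\}$ and $A\in\{x,y\}$. Then the imaginarity steering inequality holds: $$I_2=\sum_{a_1=+,-}p(a_1|y)\,\mathscr{I}_R^x(\rho_{a_1|y})+\sum_{a_2=+,-}p(a_2|x)\,\mathscr{I}_R^y(\rho_{a_2|x})\le\sqrt2 .$$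
   Context: For a density matrix $\rho$ on $\mathbb{C}^2$ and an (ordered) orthonormal basis $\{|e_0\rangle,|e_1\rangle\}$, let $\rho_e=(\langle e_i|\rho|e_j\rangle)_{i,j}$ be the matrix of $\rho$ in that basis. The robustness of imaginarity of $\rho$ in that basis is $\frac12\|\rho_e-\rho_e^T\|_1$, where $T$ is the transpose and $\|V\|_1=\operatorname{Tr}\sqrt{V^\dagger V}$. $\mathscr{I}_R^x$ denotes this quantity in the $x$-basis $\{(|0\rangle+|1\rangle)/\sqrt2,(|0\rangle-|1\rangle)/\sqrt2\}$, and $\mathscr{I}_R^y$ denotes it in the $y$-basis $\{(|0\rangle+i|1\rangle)/\sqrt2,(|0\rangle-i|1\rangle)/\sqrt2\}$. Here $p(a|A)=\operatorname{Tr}\sigma_{a|A}$ and $\rho_{a|A}=\sigma_{a|A}/p(a|A)$; terms with $p(a|A)=0$ are taken to be $0$. *)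

(* Defs.v *)
From HB Require Import structures.
From mathcomp Require Import all_boot all_order all_algebra.
From mathcomp Require Import sesquilinear spectral complex finmap.
From mathcomp Require Import all_classical all_reals all_analysis.
From mathcomp Require Import summability.

Set Implicit Arguments.
Unset Strict Implicit.
Unset Printing Implicit Defensive.

Import Order.TTheory GRing.Theory Num.Theory.
Import numFieldNormedType.Exports.

Local Open Scope ring_scope.
Local Open Scope sesquilinear_scope.
Local Open Scope classical_set_scope.
Local Open Scope complex_scope.

Section Operators.
Variables (C : numClosedFieldType) (n : nat).

(* [0 <= z] in [C] entails that [z] is real. *)
Definition psdmx (A : 'M[C]_n) : Prop :=
  A^t* = A /\ forall v : 'cV[C]_n, 0 <= (v^t* *m A *m v) 0 0.

Definition density (rho : 'M[C]_n) : Prop := psdmx rho /\ \tr rho = 1.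

(* Square root by functional calculus: for normal [A] one has
   A = U^-1 diag(d) U with U = spectralmx A unitary and d = spectral_diag A.
   Only meaningful on positive semidefinite matrices, see [sqrtmxK] and
   [sqrtmx_psd]. *)
Definition sqrtmx (A : 'M[C]_n) : 'M[C]_n :=
  invmx (spectralmx A) *m diag_mx (map_mx sqrtC (spectral_diag A))
    *m spectralmx A.

Definition trace_norm (V : 'M[C]_n) : C := \tr (sqrtmx (V^t* *m V)).

Definition in_basis (e : 'I_n -> 'cV[C]_n) (rho : 'M[C]_n) : 'M[C]_n :=
  \matrix_(i, j) ((e i)^t* *m rho *m e j) 0 0.

Definition robustness (e : 'I_n -> 'cV[C]_n) (rho : 'M[C]_n) : C :=
  2^-1 * trace_norm (in_basis e rho - (in_basis e rho)^T).

Lemma psd_spectralE (A : 'M[C]_n) : psdmx A ->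
  A = (spectralmx A)^t* *m diag_mx (spectral_diag A) *m spectralmx A.
Proof.
move=> [Ah _].
have /orthomx_spectralP {1}-> : A \is normalmx by rewrite qualifE Ah.
by rewrite invmx_unitary ?spectral_unitarymx.
Qed.

Lemma psd_spectral_diag_ge0 (A : 'M[C]_n) i :
  psdmx A -> 0 <= spectral_diag A 0 i.
Proof.
move=> Apsd; case: (Apsd) => _ /(_ ((spectralmx A)^t* *m delta_mx i 0)).
have U1 : spectralmx A *m (spectralmx A)^t* = 1%:M.
  by apply/unitarymxP; exact: spectral_unitarymx.
set U := spectralmx A in U1 *.
rewrite {1}(psd_spectralE Apsd) -/U.
rewrite trmx_mul map_mxM trmxCK -!mulmxA (mulmxA U) U1 mul1mx.
rewrite (mulmxA U) U1 mul1mx trmx_delta map_delta_mx mulmxA.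
by rewrite -rowE -colE !mxE eqxx mulr1n.
Qed.

Lemma sqrtmxK (A : 'M[C]_n) : psdmx A -> sqrtmx A *m sqrtmx A = A.
Proof.
move=> Apsd; rewrite {3}(psd_spectralE Apsd) /sqrtmx.
rewrite -invmx_unitary ?spectral_unitarymx// -!mulmxA.
rewrite (mulmxA (spectralmx A)) mulmxV ?spectral_unit// mul1mx.
congr (_ *m _); rewrite mulmxA mulmx_diag; congr (diag_mx _ *m _).
by apply/rowP => i; rewrite !mxE -expr2 sqrtCK.
Qed.

Lemma sqrtmx_psd (A : 'M[C]_n) : psdmx A -> psdmx (sqrtmx A).
Proof.
move=> Apsd; rewrite /sqrtmx invmx_unitary ?spectral_unitarymx//.
set U := spectralmx A; set d := map_mx sqrtC _.
have d0 i : 0 <= d 0 i by rewrite mxE sqrtC_ge0 psd_spectral_diag_ge0.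
split.
  rewrite !trmx_mul !map_mxM trmxCK tr_diag_mx map_diag_mx mulmxA.
  congr (_ *m diag_mx _ *m _); apply/rowP => i.
  by rewrite mxE; apply/CrealP; rewrite ger0_real.
move=> v; rewrite -!mulmxA mulmxA -[v^t* *m _]trmxCK.
rewrite (trmx_mul (v^t*)) map_mxM !trmxCK mulmxA.
set w := U *m v; rewrite mxE sumr_ge0// => i _.
rewrite mul_mx_diag; move: w d d0 => w d d0; rewrite !mxE mulrAC.
by apply: mulr_ge0; rewrite // mulrC -normCK exprn_ge0.
Qed.

End Operators.

Section Qubit.
Variable C : numClosedFieldType.

Definition ket (i : 'I_2) : 'cV[C]_2 := delta_mx i 0.

Definition xbasis (k : 'I_2) : 'cV[C]_2 :=
  (sqrtC 2)^-1 *: (ket 0 + (-1) ^+ k *: ket 1).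

Definition ybasis (k : 'I_2) : 'cV[C]_2 :=
  (sqrtC 2)^-1 *: (ket 0 + (-1) ^+ k *: ('i *: ket 1)).

End Qubit.

Inductive setting := X | Y.

(* Outcomes are booleans: [true] is +, [false] is -. *)
Definition assemblage (C : numClosedFieldType) := bool -> setting -> 'M[C]_2.

Section Assemblage.
Variables (C : numClosedFieldType) (sigma : assemblage C).

Definition prob (a : bool) (A : setting) : C := \tr (sigma a A).

(* When [prob a A = 0] this is the zero matrix, as 0^-1 = 0; every use below
   is multiplied by [prob a A]. *)
Definition cond_state (a : bool) (A : setting) : 'M[C]_2 :=
  (prob a A)^-1 *: sigma a A.

(* [sigma a A = p(a|A) rho_{a|A}] with [p(.|A)] a probability distribution
   and [rho_{a|A}] a density matrix. *)
Definition conditional_states : Prop :=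
  forall A, (forall a, psdmx (sigma a A)) /\ \sum_(a : bool) prob a A = 1.

Definition I2 : C :=
  \sum_(a1 : bool) prob a1 Y * robustness (@xbasis C) (cond_state a1 Y) +
  \sum_(a2 : bool) prob a2 X * robustness (@ybasis C) (cond_state a2 X).

End Assemblage.

Section HiddenState.
Variables (R : realType) (L : choiceType).

(* Unordered sums: limits along the finite subsets of [L]. For finite [L]
   this is the usual sum, see [has_sum_fin]. *)
Definition has_sum (f : L -> R) (s : R) : Prop :=
  partial_sum f @ totally --> s.

Definition has_mxsum m n (f : L -> 'M[R[i]]_(m, n)) (s : 'M[R[i]]_(m, n)) :
    Prop :=
  forall i j, has_sum (fun l => complex.Re (f l i j)) (complex.Re (s i j)) /\
              has_sum (fun l => complex.Im (f l i j)) (complex.Im (s i j)).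

Definition LHS_model (sigma : assemblage R[i]) (p : L -> R)
    (q : bool -> setting -> L -> R) (rho : L -> 'M[R[i]]_2) : Prop :=
  [/\ (forall l, 0 <= p l) /\ has_sum p 1,
      (forall a A l, 0 <= q a A l) /\
        (forall A l, \sum_(a : bool) q a A l = 1),
      forall l, density (rho l) &
      forall a A, has_mxsum (fun l => (p l * q a A l)%:C *: rho l) (sigma a A)].

End HiddenState.

Lemma has_sum_fin (R : realType) (L : finType) (f : L -> R) s :
  has_sum f s <-> s = \sum_l f l.
Proof.
have totallyF := @totally_filter L.
have Ff : partial_sum f @ totally --> \sum_l f l.
  apply: cvg_near_cst; near=> F.
  have FT l : l \in F.
    apply: (fsubsetP (_ : [fset x | x : L] `<=` F)%fset); last by rewrite inE.
    by near: F; exists [fset x | x : L]%fset.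
  rewrite /partial_sum -(big_seq_fsetE _ F predT f).
  rewrite -[RHS]big_enum/=; apply: perm_big; apply: uniq_perm.
  - exact: fset_uniq.
  - exact: enum_uniq.
  - by move=> l; rewrite mem_enum FT.
by split=> [fs|-> //]; exact: (cvg_unique _ fs Ff).
Unshelve. all: by end_near. Qed.

(* Main.v *)
Require Import Defs.
From mathcomp Require Import all_boot all_order all_algebra complex reals.
From mathcomp Require Import sesquilinear spectral.
From mathcomp Require Import all_classical all_analysis summability.
From mathcomp Require Import ring lra.

Import Order.TTheory GRing.Theory Num.Theory.
Import numFieldNormedType.Exports.

Local Open Scope ring_scope.

(* In the x-basis (resp. y-basis) the matrix V = rho_e - rho_e^T is
   antisymmetric with off-diagonal entry of modulus 2 |Im rho_01|
   (resp. 2 |Re rho_01|), and V^* V is scalar, so this modulus is the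
   robustness. Fixing the signs of these entries for the four states
   sigma_{a|A} turns I_2 into a linear functional of the assemblage. By
   linearity it is the sum over lambda of p(lambda) times its value on the
   responses of rho_lambda, and that value is at most
   2 (|Re rho_01| + |Im rho_01|) <= sqrt 2 for a qubit state. *)

(** * Trace norm and robustness of $2 \times 2$ matrices *)

Section TraceNorm.
Set Implicit Arguments.
Unset Strict Implicit.
Local Open Scope sesquilinear_scope.
Variable C : numClosedFieldType.

(** No particular diagonalising matrix may be assumed; but conjugation by an invertible [U] fixes
    [a%:M], so every spectral value is [a]. *)
Lemma sqrtmx_scalar n (a : C) : sqrtmx (a%:M : 'M[C]_n) = (sqrtC a)%:M.
Proof.
have an : (a%:M : 'M[C]_n) \is normalmx.
  by rewrite qualifE tr_scalar_mx map_scalar_mx scalar_mxC.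
have Uu := spectral_unit (a%:M : 'M[C]_n).
have /orthomx_spectralP := an; rewrite /sqrtmx.
move: (spectralmx _) (spectral_diag _) Uu => U d Uu E.
have -> : d = const_mx a.
  have : diag_mx d = a%:M.
    transitivity (U *m (invmx U *m diag_mx d *m U) *m invmx U).
      by rewrite !mulmxA mulmxV// mul1mx -mulmxA mulmxV// mulmx1.
    by rewrite -E scalar_mxC -mulmxA mulmxV// mulmx1.
  move=> /matrixP dE; apply/rowP => i; move: (dE i i).
  by rewrite !mxE eqxx !mulr1n.
rewrite map_const_mx diag_const_mx scalar_mxC -mulmxA mulVmx//.
exact: mulmx1.
Qed.

Lemma ord2_cases (i : 'I_2) : i = 0 \/ i = 1.
Proof. by case: i => [[|[|//]] hi]; [left|right]; apply/val_inj. Qed.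

Lemma trace_norm_antisym (V : 'M[C]_2) :
  V^T = - V -> trace_norm V = 2 * `|V 0 1|.
Proof.
move=> /matrixP VT.
have diag0 i : V i i = 0.
  move: (VT i i); rewrite !mxE => /eqP.
  by rewrite -addr_eq0 -mulr2n mulrn_eq0 => /eqP.
have V10 : V 1 0 = - V 0 1 by move: (VT 0 1); rewrite !mxE.
rewrite /trace_norm (_ : V^t* *m V = (`|V 0 1| ^+ 2)%:M); last first.
  apply/matrixP => i j; rewrite !mxE big_ord_recl big_ord1 !mxE /=.
  have -> : lift ord0 ord0 = 1 :> 'I_2 by apply/val_inj.
  rewrite normCK.
  have [->|->] := ord2_cases i; have [->|->] := ord2_cases j;
    rewrite ?diag0 ?V10 ?rmorph0 ?rmorphN ?mul0r ?mulr0;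
    rewrite ?addr0 ?add0r ?mulrNN //=.
    by rewrite mulr1n mulrC.
  by rewrite mulr1n mulrC.
by rewrite sqrtmx_scalar mxtrace_scalar sqrCK // mulr_natl.
Qed.

Lemma robustnessE (e : 'I_2 -> 'cV[C]_2) (r : 'M[C]_2) :
  robustness e r = `|in_basis e r 0 1 - in_basis e r 1 0|.
Proof.
rewrite /robustness trace_norm_antisym; last by rewrite linearB /= trmxK opprB.
by rewrite mulKf ?pnatr_eq0 // !mxE.
Qed.

Lemma qubit_formE (u v : 'cV[C]_2) (r : 'M[C]_2) :
  (u^t* *m r *m v) 0 0 =
  (u 0 0)^* * r 0 0 * v 0 0 + (u 0 0)^* * r 0 1 * v 1 0
  + (u 1 0)^* * r 1 0 * v 0 0 + (u 1 0)^* * r 1 1 * v 1 0.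
Proof.
rewrite !mxE big_ord_recl big_ord1 !mxE !big_ord_recl !big_ord0 !mxE /=.
have -> : lift ord0 ord0 = 1 :> 'I_2 by apply/val_inj.
ring.
Qed.

Lemma in_basisE (e : 'I_2 -> 'cV[C]_2) (r : 'M[C]_2) i j : in_basis e r i j =
  (e i 0 0)^* * r 0 0 * e j 0 0 + (e i 0 0)^* * r 0 1 * e j 1 0
  + (e i 1 0)^* * r 1 0 * e j 0 0 + (e i 1 0)^* * r 1 1 * e j 1 0.
Proof. by rewrite mxE qubit_formE. Qed.

Let u : C := (sqrtC 2)^-1.

Let u_conj : u^* = u.
Proof. by apply/CrealP; rewrite realV ger0_real // sqrtC_ge0. Qed.

Let u_sqr : u ^+ 2 * 2 = 1.
Proof. by rewrite exprVn sqrtCK mulVf ?pnatr_eq0. Qed.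

Lemma robustness_xbasis (r : 'M[C]_2) :
  robustness (@xbasis C) r = `|r 1 0 - r 0 1|.
Proof.
rewrite robustnessE; congr `|_|; rewrite !in_basisE !mxE /= !expr0 !expr1.
rewrite !(rmorphM, rmorphD, rmorphN, rmorph1, rmorph0, mulr1n, mulr0n) /=.
rewrite -/u u_conj.
(* Writing [1] as [u ^+ 2 * 2] turns the goal into a polynomial identity in [u]. *)
by rewrite -[RHS]mul1r -[X in _ = X * _]u_sqr; ring.
Qed.

Lemma robustness_ybasis (r : 'M[C]_2) :
  robustness (@ybasis C) r = `|r 1 0 + r 0 1|.
Proof.
(* The difference of the two entries is [- 'i * (r 1 0 + r 0 1)]; the norm absorbs the sign and the
   unit ['i]. *)
rewrite robustnessE -[RHS]mul1r -(normCi C) -normrM -normrN; congr `|_|.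
rewrite !in_basisE !mxE /= !expr0 !expr1.
rewrite !(rmorphM, rmorphD, rmorphN, rmorph1, rmorph0, mulr1n, mulr0n) /=.
rewrite -/u u_conj ?conjCi.
by rewrite -[RHS]mul1r -[X in _ = X * _]u_sqr; ring.
Qed.

(** Robustness is homogeneous, so equality holds for nonzero [p]. For [p = 0] the left side is [0],
    whatever [s] is, which leaves only an inequality. *)
Lemma prob_robustness_scale_le (e : 'I_2 -> 'cV[C]_2) (s : 'M[C]_2) (p : C) :
  0 <= p -> p * robustness e (p^-1 *: s) <= robustness e s.
Proof.
move=> p0.
have -> : robustness e (p^-1 *: s) = p^-1 * robustness e s.
  rewrite !robustnessE !in_basisE !mxE.
  rewrite -[X in X * `|_|]ger0_norm ?invr_ge0//.
  by rewrite -normrM; congr `|_|; ring.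
have [->|pn0] := eqVneq p 0; last by rewrite mulVKf.
by rewrite mul0r robustnessE normr_ge0.
Qed.
End TraceNorm.

Local Open Scope complex_scope.

(** * Linearity and monotonicity of unordered sums *)

Section HasSum.
Set Implicit Arguments.
Unset Strict Implicit.
Local Open Scope classical_set_scope.
Variables (R : realType) (L : choiceType).
Implicit Types (f g : L -> R) (s t : R).

Lemma has_sumD f g s t : has_sum f s -> has_sum g t ->
  has_sum (fun l => f l + g l) (s + t).
Proof.
move=> fs gt; rewrite /has_sum.
have -> : partial_sum (fun l => f l + g l) = partial_sum f \+ partial_sum g.
  by apply/funext => F; rewrite /partial_sum /= big_split.
have totallyF := @totally_filter L.
exact: cvgD fs gt.
Qed.

Lemma has_sumZ (c : R) f s : has_sum f s -> has_sum (fun l => c * f l) (c * s).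
Proof.
move=> fs; rewrite /has_sum.
have -> : partial_sum (fun l => c * f l) = (fun F => c * partial_sum f F).
  by apply/funext => F; rewrite /partial_sum /= mulr_sumr.
have totallyF := @totally_filter L.
exact: cvgMr fs.
Qed.

Lemma has_sum_le f g s t : (forall l, f l <= g l) ->
  has_sum f s -> has_sum g t -> s <= t.
Proof.
move=> fg fs gt.
have totallyF := @totally_filter L.
rewrite -subr_ge0; apply: (cvgr_to_ge (cvgB gt fs)).
by near=> F; rewrite /= subr_ge0 /partial_sum ler_sum.
Unshelve. all: by end_near. Qed.
End HasSum.

Arguments has_sumZ {R L} c {f s} fs.

(** * Reduction to real and imaginary parts over [R[i]] *)

Section RealParts.
Set Implicit Arguments.
Unset Strict Implicit.
Local Open Scope sesquilinear_scope.
Variable R : realType.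

Lemma psdmx_offdiag n (A : 'M[R[i]]_n) i j : psdmx A ->
  complex.Re (A j i) = complex.Re (A i j) /\
  complex.Im (A j i) = - complex.Im (A i j).
Proof.
move=> [/matrixP/(_ j i)]; rewrite !mxE => <- _.
by case: (A i j).
Qed.

Lemma sqrtC2E : sqrtC (2 : R[i]) = (Num.sqrt 2)%:C.
Proof.
rewrite -[LHS]/(sqrtC 2) (_ : 2 = (Num.sqrt 2)%:C ^+ 2 :> R[i]); last first.
  by rewrite -rmorphXn /= sqr_sqrtr ?ler0n // rmorph_nat.
by rewrite sqrCK // lecR sqrtr_ge0.
Qed.

(* Positivity on the vector (sqrt 2, -s + i t), where s and t are the signs of
   the real and imaginary parts of the off-diagonal entry. *)
Lemma density_offdiag_le (r : 'M[R[i]]_2) : density r ->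
  2 * (`|complex.Re (r 0 1)| + `|complex.Im (r 0 1)|) <= Num.sqrt 2.
Proof.
move=> [rpsd rtr].
have [Re10 Im10] := psdmx_offdiag 0 1 rpsd.
rewrite !normrEsign.
set s := (-1) ^+ _; set t := (-1) ^+ (complex.Im _ < 0)%R.
have s2 : s ^+ 2 = 1 by rewrite sqrr_sign.
have t2 : t ^+ 2 = 1 by rewrite sqrr_sign.
case: rpsd => _ /(_ (\col_k if k == 0 then (Num.sqrt 2)%:C else (- s) +i* t)).
have h2 : Num.sqrt 2 ^+ 2 = 2 :> R by rewrite sqr_sqrtr.
have : 0 < Num.sqrt 2 :> R by rewrite sqrtr_gt0.
move: rtr; rewrite /mxtrace big_ord_recl big_ord1.
have -> : lift ord0 ord0 = 1 :> 'I_2 by apply/val_inj.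
rewrite qubit_formE !mxE /=.
move: (Num.sqrt 2) s t s2 t2 h2 Re10 Im10 => h s t s2 t2 h2.
case: (r 0 0) (r 0 1) (r 1 0) (r 1 1)
  => [a a'] [b b'] [c c'] [d d'] /= -> -> [tr _] h0.
rewrite lecE /= => /andP[_ ge0].
have {}ge0 :
  0 <= h ^+ 2 * a + (s ^+ 2 + t ^+ 2) * d - h * (2 * (s * b + t * b')).
  by apply: (le_trans ge0); rewrite le_eqVlt; apply/orP; left; apply/eqP; ring.
(* Both components of the vector have squared modulus 2, so the diagonal contributes twice the trace
   and the form equals [2 - h * (2 * (s * b + t * b'))]. Multiplying the goal by [h] gives exactly
   its nonnegativity. *)
rewrite -(ler_pM2l h0) -[h * h]expr2.
by move: ge0; rewrite s2 t2 h2 subr_ge0 => /le_trans; apply; lra.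
Qed.

Lemma robustness_xbasis_psd (s : 'M[R[i]]_2) : psdmx s ->
  robustness (@xbasis R[i]) s = (2 * `|complex.Im (s 0 1)|)%:C.
Proof.
move=> /(psdmx_offdiag 0 1) [Re10 Im10]; rewrite robustness_xbasis.
have -> : s 1 0 - s 0 1 = - (2 * complex.Im (s 0 1))%:C * 'i.
  move: Re10 Im10; case: (s 1 0) (s 0 1) => [a b] [c d] /= -> ->.
  by apply/eqP; rewrite eq_complex /=; apply/andP; split; apply/eqP; ring.
rewrite normrM normCi mulr1 normrN normc_def /= expr0n addr0.
by rewrite sqrtr_sqr normrM ger0_norm.
Qed.

Lemma robustness_ybasis_psd (s : 'M[R[i]]_2) : psdmx s ->
  robustness (@ybasis R[i]) s = (2 * `|complex.Re (s 0 1)|)%:C.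
Proof.
move=> /(psdmx_offdiag 0 1) [Re10 Im10]; rewrite robustness_ybasis.
have -> : s 1 0 + s 0 1 = (2 * complex.Re (s 0 1))%:C.
  move: Re10 Im10; case: (s 1 0) (s 0 1) => [a b] [c d] /= -> ->.
  by apply/eqP; rewrite eq_complex /=; apply/andP; split; apply/eqP; ring.
by rewrite normc_def /= expr0n addr0 sqrtr_sqr normrM ger0_norm.
Qed.

Lemma psdmx_trace_ge0 n (s : 'M[R[i]]_n) : psdmx s -> 0 <= \tr s.
Proof.
move=> [_ s0]; apply: sumr_ge0 => i _.
have := s0 (delta_mx i 0); rewrite trmx_delta map_delta_mx.
by rewrite -rowE -colE !mxE.
Qed.

(** The weight [prob a A] cancels the normalisation of [cond_state], leaving the robustness of
    [sigma a A] itself, which is linear in the entries up to an absolute value. *)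
Lemma I2_le (sigma : assemblage R[i]) : conditional_states sigma ->
  I2 sigma <= (\sum_(a : bool) 2 * `|complex.Im (sigma a Y 0 1)|
    + \sum_(a : bool) 2 * `|complex.Re (sigma a X 0 1)|)%:C.
Proof.
move=> cs; rewrite raddfD !raddf_sum /=; apply: lerD; apply: ler_sum => a _.
  have [/(_ a) psd _] := cs Y; rewrite -robustness_xbasis_psd //.
  exact/prob_robustness_scale_le/psdmx_trace_ge0.
have [/(_ a) psd _] := cs X; rewrite -robustness_ybasis_psd //.
exact/prob_robustness_scale_le/psdmx_trace_ge0.
Qed.

(** The signs are dictated by [sigma] and need not match those of a given hidden state, whence only
    an inequality. *)
Lemma sign_mul_le (k : nat) (x : R) : (-1) ^+ k * x <= `|x|.
Proof.
apply: (le_trans (ler_norm _)).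
by rewrite normrM normrX normrN1 expr1n mul1r.
Qed.

Lemma LHS_model_offdiag (L : choiceType) (sigma : assemblage R[i]) p q
    (rho : L -> 'M[R[i]]_2) a A : LHS_model sigma p q rho ->
  has_sum (fun l => p l * q a A l * complex.Re (rho l 0 1))
    (complex.Re (sigma a A 0 1)) /\
  has_sum (fun l => p l * q a A l * complex.Im (rho l 0 1))
    (complex.Im (sigma a A 0 1)).
Proof.
case=> _ _ _ /(_ a A 0 1) [hRe hIm]; split.
  rewrite (_ : (fun l => _) =
    (fun l => complex.Re (((p l * q a A l)%:C *: rho l) 0 1))) //.
  by apply/funext => l; rewrite mxE; case: (rho l 0 1) => x y /=; ring.
rewrite (_ : (fun l => _) =
  (fun l => complex.Im (((p l * q a A l)%:C *: rho l) 0 1))) //.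
by apply/funext => l; rewrite mxE; case: (rho l 0 1) => x y /=; ring.
Qed.
End RealParts.

Theorem mainTheorem1 (R : realType) (L : choiceType)
    (sigma : assemblage R[i]) (p : L -> R) (q : bool -> setting -> L -> R)
    (rho : L -> 'M[R[i]]_2) :
  conditional_states sigma ->
  LHS_model sigma p q rho ->
  I2 sigma <= sqrtC 2.
Proof.
move=> cs lhs; apply: (le_trans (I2_le cs)); rewrite sqrtC2E lecR.
rewrite !big_bool /= !normrEsign.
have hY a := (LHS_model_offdiag a Y lhs).2.
have hX a := (LHS_model_offdiag a X lhs).1.
(* From here the four signs are arbitrary, independent of [sigma], and the left side is linear in
   the entries. *)
move: (complex.Im _ < 0)%R (complex.Im _ < 0)%R (complex.Re _ < 0)%R
  (complex.Re _ < 0)%R => b2 b1 b4 b3.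
have [[p0 p1] [q0 q1] dens _] := lhs.
have hl := has_sumD
  (has_sumD (has_sumZ 2 (has_sumZ ((-1) ^+ b1) (hY true)))
    (has_sumZ 2 (has_sumZ ((-1) ^+ b2) (hY false))))
  (has_sumD (has_sumZ 2 (has_sumZ ((-1) ^+ b3) (hX true)))
    (has_sumZ 2 (has_sumZ ((-1) ^+ b4) (hX false)))).
(* As [p] has sum 1, the bound is itself a sum over the hidden variable, and the comparison becomes
   termwise. *)
have hr := has_sumZ (Num.sqrt 2) p1; rewrite mulr1 in hr.
apply: (has_sum_le _ hl hr) => l /=.
have := density_offdiag_le (dens l).
move: (complex.Re _) (complex.Im _) => x y xy.
have := q1 X l; have := q1 Y l; rewrite !big_bool /= => qY qX.
have qs a A k z : q a A l * ((-1) ^+ k * z) <= q a A l * `|z|.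
  by apply: ler_wpM2l => //; apply: sign_mul_le.
have : p l * (2 * (q true Y l * ((-1) ^+ b1 * y)
   + q false Y l * ((-1) ^+ b2 * y) + q true X l * ((-1) ^+ b3 * x)
   + q false X l * ((-1) ^+ b4 * x)))
  <= p l * Num.sqrt 2.
  apply: ler_wpM2l => //; apply: le_trans xy; rewrite ler_pM2l //.
  (* The responses to each setting sum to 1, so each absolute value splits over the two outcomes and
     is matched term by term through [qs]. *)
  have -> : `|x| + `|y| = q true Y l * `|y| + q false Y l * `|y|
     + q true X l * `|x| + q false X l * `|x|.
    by rewrite -mulrDl qY -addrA -mulrDl qX !mul1r addrC.
  by rewrite !lerD.
by congr (_ <= _); ring.
Qed.
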